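(* Let $G$ be a finite group. Suppose that for some chargeon $C$ and fluxion $F$ of $\mathcal{Z}(G)$ with $C\neq F$, the permutation matrix $P$ of the transposition $(C,F)$ of simple objects is a modular invariant for $\mathcal{Z}(G)$. Then $G\simeq \mathbf{H}^{+}\rtimes\mathbf{H}^{\times}$ for some (finite) near-field $\mathbf{H}$. Conversely, for every finite near-field $\mathbf{H}$, the group $G=\mathbf{H}^{+}\rtimes\mathbf{H}^{\times}$ has a chargeon $C$ and a fluxion $F\neq C$ in $\mathcal{Z}(G)$ such that the permutation matrix of the transposition $(C,F)$ is a modular invariant for $\mathcal{Z}(G)$.
   Context: For a finite group $G$, $\mathcal{Z}(G)$ is the modular tensor category of finite-dimensional complex representations of the Drinfeld double $D(G)$. Its simple objects are indexed, up to isomorphism, by pairs $(\overline{a},\pi)$, where $\overline{a}$ is a conjugacy class of $G$ with chosen representative $a$ and $\pi$ is an irreducible complex representation of the centralizer $Z(a)=\{h\in G: ha=ah\}$. A simple object $(\overline a,\pi)$ is a chargeon if $a=e$ and a fluxion if $\pi$ is the trivial representation; $\mathbf{0}=(\overline e,\mathbf 1)$ is the trivial object. The $S$-matrix, indexed by simple objects, is $S_{(\overline{a},\pi)(\overline{a'},\pi')}=\frac{1}{|Z(a)|\,|Z(a')|}\sum_{h\in G:\ ha'h^{-1}\in Z(a)}\mathrm{tr}_{\pi}(ha'^{-1}h^{-1})\,\mathrm{tr}_{\pi'}(h^{-1}a^{-1}h)$, and the $T$-matrix is diagonal with $T_{(\overline{a},\pi)(\overline a,\pi)}=\mathrm{tr}_{\pi}(a)/\mathrm{tr}_{\pi}(e)$,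 where $\mathrm{tr}_\pi$ denotes the character. A modular invariant is a matrix $M$ indexed by simple objects, with non-negative integer entries and $M_{\mathbf{0}\mathbf{0}}=1$, that commutes with both $S$ and $T$. A near-field is a set $\mathbf{H}$ with binary operations $+$ and $\times$ such that $(\mathbf{H},+)$ is an abelian group with identity $0$; $0\times x=x\times 0=0$ for all $x$; $(\mathbf{H}\setminus\{0\},\times)$ is a group with identity $1$; and $x\times(y+z)=x\times y+x\times z$ for all $x,y,z$ (right distributivity is not assumed). $\mathbf{H}^{+}\rtimes\mathbf{H}^{\times}$ is the group of pairs $(a,\alpha)$ with $a\in\mathbf{H}$, $\alpha\in\mathbf{H}\setminus\{0\}$, and multiplication $(a,\alpha)(b,\beta)=(a+\alpha\times b,\alpha\times\beta)$. *)

(* Defs.v *)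
From HB Require Import structures.
From mathcomp Require Import all_boot all_order all_algebra all_fingroup all_solvable all_field all_character.
Set Implicit Arguments.
Unset Strict Implicit.
Unset Printing Implicit Defensive.
Import Order.TTheory GRing.Theory Num.Theory.
Local Open Scope group_scope.
Local Open Scope ring_scope.

(* Simple objects of Z(G) = Rep(D(G)).                                  *)
(* An object is a pair (a, i) with a : gT and i an index of an          *)
(* irreducible character of the centralizer Z(a) = 'C_G[a].             *)
(* The simple objects (up to iso) are those pairs with a \in G and a    *)
(* the chosen representative (repr) of its G-conjugacy class.           *)

Definition obj (gT : finGroupType) (G : {group gT}) : finType :=
  {a : gT & Iirr 'C_G[a]}.

Definition simple_obj (gT : finGroupType) (G : {group gT}) (X : obj G) : bool :=
  (tag X \in G) && (tag X == repr (tag X ^: G)%g).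

Definition chargeon (gT : finGroupType) (G : {group gT}) (X : obj G) : bool :=
  tag X == 1%g.
Definition fluxion (gT : finGroupType) (G : {group gT}) (X : obj G) : bool :=
  tagged X == 0%R.

Definition obj0 (gT : finGroupType) (G : {group gT}) : obj G :=
  @Tagged gT 1%g (fun a => Iirr 'C_G[a]) 0%R.

Definition Smx (gT : finGroupType) (G : {group gT}) (X Y : obj G) : algC :=
  let a := tag X in let i := tagged X in
  let a' := tag Y in let j := tagged Y in
  ((#|'C_G[a]|)%:R * (#|'C_G[a']|)%:R)^-1 *
   \sum_(h in G | (h * a' * h^-1)%g \in 'C_G[a])
      'chi_i (h * a'^-1 * h^-1)%g * 'chi_j (h^-1 * a^-1 * h)%g.

Definition Tdiag (gT : finGroupType) (G : {group gT}) (X : obj G) : algC :=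
  'chi_(tagged X) (tag X) / 'chi_(tagged X) 1%g.

Definition modular_invariant (gT : finGroupType) (G : {group gT})
    (M : obj G -> obj G -> nat) : Prop :=
  [/\ M (obj0 G) (obj0 G) = 1%N,
      (forall X Y : obj G, simple_obj X -> simple_obj Y ->
        \sum_(Z : obj G | simple_obj Z) ((M X Z)%:R * Smx Z Y)%R
        = \sum_(Z : obj G | simple_obj Z) (Smx X Z * (M Z Y)%:R)%R) &
      (forall X Y : obj G, simple_obj X -> simple_obj Y ->
        ((M X Y)%:R * Tdiag Y = Tdiag X * (M X Y)%:R)%R)].

Definition transp (gT : finGroupType) (G : {group gT}) (C F X : obj G) : obj G :=
  if X == C then F else if X == F then C else X.

Definition transp_mx (gT : finGroupType) (G : {group gT}) (C F : obj G)
    (X Y : obj G) : nat :=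
  if transp C F X == Y then 1%N else 0%N.

Record nearField := NearField {
  nf_sort :> finType;
  nf_zero : nf_sort;
  nf_add : nf_sort -> nf_sort -> nf_sort;
  nf_opp : nf_sort -> nf_sort;
  nf_one : nf_sort;
  nf_mul : nf_sort -> nf_sort -> nf_sort;
  nf_addA : associative nf_add;
  nf_addC : commutative nf_add;
  nf_add0 : left_id nf_zero nf_add;
  nf_addN : left_inverse nf_zero nf_opp nf_add;
  nf_mul0l : forall x, nf_mul nf_zero x = nf_zero;
  nf_mul0r : forall x, nf_mul x nf_zero = nf_zero;
  nf_one_neq0 : nf_one != nf_zero;
  nf_mul_neq0 : forall x y, x != nf_zero -> y != nf_zero -> nf_mul x y != nf_zero;
  nf_mulA : forall x y z, x != nf_zero -> y != nf_zero -> z != nf_zero ->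
     nf_mul x (nf_mul y z) = nf_mul (nf_mul x y) z;
  nf_mul1l : forall x, x != nf_zero -> nf_mul nf_one x = x;
  nf_mul1r : forall x, x != nf_zero -> nf_mul x nf_one = x;
  nf_mulV : forall x, x != nf_zero -> exists2 y, y != nf_zero &
     (nf_mul y x = nf_one /\ nf_mul x y = nf_one);
  nf_mulDr : forall x y z, nf_mul x (nf_add y z) = nf_add (nf_mul x y) (nf_mul x z)
}.

Section NearFieldGroup.
Variable N : nearField.

Local Notation "0" := (nf_zero N).
Local Notation "1" := (nf_one N).
Local Notation "x + y" := (nf_add x y).
Local Notation "x * y" := (nf_mul x y).

Definition nf_units : finType := {x : N | x != 0}.

Definition nf_uval (u : nf_units) : N := val u.

Lemma nf_mulA_all (x y z : N) : x * (y * z) = (x * y) * z.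
Proof.
have [->|x0] := eqVneq x 0; first by rewrite !nf_mul0l.
have [->|y0] := eqVneq y 0; first by rewrite nf_mul0l !nf_mul0r nf_mul0l.
have [->|z0] := eqVneq z 0; first by rewrite !nf_mul0r.
exact: nf_mulA.
Qed.

Lemma nf_mul1l_all (x : N) : 1 * x = x.
Proof. by have [->|x0] := eqVneq x 0; [rewrite nf_mul0r | exact: nf_mul1l]. Qed.

Definition nf_umul (u v : nf_units) : nf_units :=
  Sub (val u * val v) (nf_mul_neq0 (valP u) (valP v)).

Definition nf_uone : nf_units := Sub 1 (nf_one_neq0 N).

Definition nf_inv (x : N) : N :=
  odflt 1 [pick y | (y != 0) && (y * x == 1)].

Lemma nf_invP (x : N) : x != 0 -> nf_inv x != 0 /\ nf_inv x * x = 1.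
Proof.
move=> x0; rewrite /nf_inv; case: pickP => [y /andP[y0 /eqP yx]|H] //=.
have [y y0 [yx _]] := nf_mulV x0.
by move: (H y); rewrite y0 yx eqxx.
Qed.

Definition nf_uinv (u : nf_units) : nf_units :=
  Sub (nf_inv (val u)) (proj1 (nf_invP (valP u))).

Definition nf_sd : finType := (N * nf_units)%type.

Definition nf_sd_mul (x y : nf_sd) : nf_sd :=
  (x.1 + nf_uval x.2 * y.1, nf_umul x.2 y.2).
Definition nf_sd_one : nf_sd := (0, nf_uone).
Definition nf_sd_inv (x : nf_sd) : nf_sd :=
  (nf_opp (nf_inv (nf_uval x.2) * x.1), nf_uinv x.2).

Lemma nf_sd_mulA : associative nf_sd_mul.
Proof.
move=> [a u] [b v] [c w]; rewrite /nf_sd_mul /=; congr (_, _).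
  by rewrite nf_mulDr nf_addA /nf_uval /= nf_mulA_all.
by apply: val_inj; rewrite /= nf_mulA_all.
Qed.

Lemma nf_sd_mul1 : left_id nf_sd_one nf_sd_mul.
Proof.
move=> [a u]; rewrite /nf_sd_mul /=; congr (_, _).
  by rewrite /nf_uval /= nf_mul1l_all nf_add0.
by apply: val_inj; rewrite /= nf_mul1l_all.
Qed.

Lemma nf_sd_mulV : left_inverse nf_sd_one nf_sd_inv nf_sd_mul.
Proof.
move=> [a u]; rewrite /nf_sd_mul /nf_sd_inv /nf_sd_one /=; congr (_, _).
  by rewrite /nf_uval /= nf_addN.
by apply: val_inj; rewrite /= (proj2 (nf_invP (valP u))).
Qed.

Definition nf_sdprod : Type := nf_sd.
HB.instance Definition _ := Finite.on nf_sdprod.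
HB.instance Definition _ :=
  Finite_isGroup.Build nf_sdprod nf_sd_mulA nf_sd_mul1 nf_sd_mulV.

End NearFieldGroup.

Lemma nf_sdprod_mulE (N : nearField) (x y : nf_sdprod N) :
  (x * y)%g = (nf_add x.1 (nf_mul (val x.2) y.1), nf_umul x.2 y.2).
Proof. by []. Qed.

(* Main.v *)
(* Write n for the size of the class of a, where F = (a, 1), and C = (e, pi).
   Comparing the S-entries of C and F against 0 and against the other chargeons
   (e, rho) gives pi(e) = n and rho(a) = rho(e) for every rho <> pi; column
   orthogonality then forces pi(a) = -1, |Z(a)| = n + 1 and |G| = n (n + 1).
   The equality S_CC = S_FF says that all conjugates of a commute with a, so
   K = Z(a) is the union of {e} and the class of a: an abelian normal subgroup
   on whose nontrivial elements G / K acts regularly.  Its index is n, which is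
   coprime to n + 1, so Schur-Zassenhaus gives a complement H, and
   transporting the regular action of H to K \ {e} along h |-> h a h^-1 defines
   the near-field multiplication on K.
   Conversely, for such K the character induced from any nontrivial linear
   character of K takes the values n at e, -1 on K \ {e} and 0 off K; it has norm
   1, and this is the pi of the chargeon to be exchanged with (a, 1). *)
Require Import Defs.
From mathcomp Require Import all_boot all_order all_algebra all_fingroup all_solvable all_field all_character.
From mathcomp Require Import ring.
Set Implicit Arguments.
Unset Strict Implicit.
Unset Printing Implicit Defensive.
Import Order.TTheory GRing.Theory Num.Theory.
Local Open Scope group_scope.
Local Open Scope ring_scope.

(** * S-matrix entries of chargeons and fluxions *)

Section DoubleS.
Variables (gT : finGroupType) (G : {group gT}).
Implicit Types X Y Z : obj G.

Definition mkobj (a : gT) (i : Iirr 'C_G[a]) : obj G :=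
  Tagged (fun a => Iirr 'C_G[a]) i.

Lemma mem_cent1J (a b h : gT) : ((a ^ h)%g \in 'C[b]%g) = (a \in 'C[b ^ h^-1])%g.
Proof. by rewrite cent1J mem_conjg invgK. Qed.

Lemma mulgVr_conj (h b : gT) : (h * b * h^-1 = b ^ h^-1)%g.
Proof. by rewrite conjgE invgK mulgA. Qed.

Lemma Smx_sym X Y : tag X \in G -> tag Y \in G -> Smx X Y = Smx Y X.
Proof.
case: X Y => [a i] [b j] /= aG bG; rewrite /Smx /=; congr (_ * _).
  by rewrite mulrC.
rewrite (reindex_inj invg_inj) /=; apply: eq_big => [h | h _]; last first.
  by rewrite invgK mulrC.
rewrite groupV; case hG: (h \in G) => //=; rewrite !mulgVr_conj !in_setI.
rewrite invgK (groupJ aG (groupVr hG)) (groupJ bG hG) /=.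
by rewrite mem_cent1J cent1C.
Qed.

(** Since ['C_G[1]] is all of [G], every [h] contributes, and because ['chi_i] is a class function
    the summand does not depend on [h]. *)
Lemma Smx_chargeon (i : Iirr 'C_G[1]) (b : gT) (j : Iirr 'C_G[b]) : b \in G ->
  Smx (mkobj i) (mkobj j) = 'chi_i b^-1%g * 'chi_j 1%g / #|'C_G[b]|%:R.
Proof.
move=> bG; have eqC : 'C_G[1]%g = G by rewrite cent11T setIT.
have cardC : #|'C_G[1]%g| = #|G| by rewrite eqC.
have inC x : x \in G -> x \in 'C_G[1]%G by move=> xG; rewrite /= -[_ \in _]/(x \in 'C_G[1]%g) eqC.
rewrite /Smx /= cardC.
rewrite (eq_big (fun h => h \in G) (fun _ => 'chi_i b^-1%g * 'chi_j 1%g)) /=; first last.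
- move=> h /andP[hG _]; rewrite invg1 mulg1 mulVg mulgVr_conj.
  by rewrite cfunJ // inC ?groupV.
- move=> h; case hG: (h \in G) => //=.
  by apply: inC; rewrite !groupM ?groupV.
by rewrite sumr_const -mulr_natl; field; rewrite !neq0CG.
Qed.

Lemma Smx_fluxion (a : gT) (b : gT) (j : Iirr 'C_G[b]) :
  a \in G -> b \in G ->
  Smx (mkobj (0 : Iirr 'C_G[a])) (mkobj j) = (#|'C_G[a]|%:R * #|'C_G[b]|%:R)^-1 *
    \sum_(h in G | (a ^ h)%g \in 'C_G[b]) 'chi_j (a^-1 ^ h)%g.
Proof.
move=> aG bG; rewrite /Smx /=; congr (_ * _).
have cond h : h \in G -> ((h * b * h^-1)%g \in 'C_G[a]) = ((a ^ h)%g \in 'C_G[b]).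
  move=> hG; rewrite mulgVr_conj !in_setI (groupJ aG hG) (groupJ bG (groupVr hG)) /=.
  by rewrite mem_cent1J invgK cent1C.
apply: eq_big => [h | h /andP[hG Ch]].
  by case hG: (h \in G); rewrite //= cond.
rewrite irr0 cfun1E conjgE !mulgA.
suff ->: (h * b^-1 * h^-1)%g \in 'C_G[a] by rewrite mul1r.
by rewrite -groupV !invMg !invgK mulgA.
Qed.

Lemma simple_tag X : simple_obj X -> tag X \in G.
Proof. by case/andP. Qed.

Lemma simple_obj_conj X Y : simple_obj X -> simple_obj Y ->
  tag Y \in (tag X ^: G)%g -> tag X = tag Y.
Proof.
case/andP=> _ /eqP eqX /andP[_ /eqP eqY] /class_eqP eqYX.
by rewrite eqX eqY eqYX.
Qed.

Lemma transpK (C F : obj G) : involutive (transp C F).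
Proof.
move=> X; rewrite /transp; case: (eqVneq X C) => [->|XC]; first by rewrite eqxx; case: eqP.
case: (eqVneq X F) => [->|XF]; first by rewrite eqxx.
by rewrite (negPf XC) (negPf XF).
Qed.

Lemma simple_transp (C F X : obj G) :
  simple_obj C -> simple_obj F -> simple_obj X -> simple_obj (transp C F X).
Proof. by move=> sC sF sX; rewrite /transp; case: eqP => // _; case: eqP. Qed.

Lemma transp_mx_suml (C F X Y : obj G) :
  simple_obj C -> simple_obj F -> simple_obj X ->
  \sum_(Z : obj G | simple_obj Z) (transp_mx C F X Z)%:R * Smx Z Y
    = Smx (transp C F X) Y.
Proof.
move=> sC sF sX; rewrite (bigD1 (transp C F X)) ?simple_transp //=.
rewrite big1 ?addr0 => [|Z /andP[_ /negPf nZ]]; rewrite /transp_mx ?eqxx ?mul1r //.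
by rewrite eq_sym nZ mul0r.
Qed.

Lemma transp_mx_sumr (C F X Y : obj G) :
  simple_obj C -> simple_obj F -> simple_obj Y ->
  \sum_(Z : obj G | simple_obj Z) Smx X Z * (transp_mx C F Z Y)%:R
    = Smx X (transp C F Y).
Proof.
move=> sC sF sY; rewrite (bigD1 (transp C F Y)) ?simple_transp //=.
rewrite big1 ?addr0 => [|Z /andP[_ nZ]]; rewrite /transp_mx ?transpK ?eqxx ?mulr1 //.
by rewrite (canF_eq (@transpK C F)) (negPf nZ) mulr0.
Qed.

(** [C] and [F] both have twist 1, so the transposition always commutes with [T]. Commuting with [S]
    means that moving the transposition from one index of [S] to the other changes nothing. *)
Lemma modular_transpP (C F : obj G) :
  simple_obj C -> simple_obj F -> chargeon C -> fluxion F ->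
  modular_invariant (transp_mx C F) <->
  transp C F (obj0 G) = obj0 G /\
  forall X Y : obj G, simple_obj X -> simple_obj Y ->
    Smx (transp C F X) Y = Smx X (transp C F Y).
Proof.
move=> sC sF chC flF; split=> [[M0 MS _]|[M0 MS]].
  split=> [|X Y sX sY].
    by move: M0; rewrite /transp_mx; case: eqP.
  by rewrite -transp_mx_suml // MS // transp_mx_sumr.
split=> [|X Y sX sY|X Y sX sY]; first by rewrite /transp_mx M0 eqxx.
  by rewrite transp_mx_suml // transp_mx_sumr // MS.
have TC : Tdiag C = 1.
  rewrite /Tdiag; case: (C) chC => [a i] /eqP /= a1; subst a.
  by rewrite divff // irr1_neq0.
have TF : Tdiag F = 1.
  rewrite /Tdiag (eqP flF) irr0 !cfun1E group1 divr1 in_setI simple_tag //=.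
  by rewrite cent1id.
rewrite /transp_mx; case: eqP => [<-|_]; last by rewrite mul0r mulr0.
rewrite mul1r mulr1 /transp; case: eqP => [->|_]; first by rewrite TC TF.
by case: eqP => [->|//]; rewrite TC TF.
Qed.

End DoubleS.

(** * From a modular transposition to a sharp normal subgroup *)

Section Sharp.
Variable gT : finGroupType.
Implicit Types G K : {group gT}.

(* These properties characterise K = H^+ inside G = H^+ ><| H^* for a near-field H. *)
Definition sharp G K :=
  [/\ (K <| G)%g, K :!=: 1%g, {in (K^#)%g, forall a, 'C_G[a]%g = K}
    & {in (K^#)%g, forall a, (a ^: G = K^#)%g}].

Lemma sharp_abelian G K : sharp G K -> abelian K.
Proof.
case=> _ _ cK _.
apply/centsP=> x xK y yK; have [->|y1] := eqVneq y 1%g; first exact: commute1.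
have : x \in 'C_G[y]%g by rewrite cK // in_setD1 y1.
by case/setIP=> _ /cent1P.
Qed.

Lemma simple_mkobj1 G (i : Iirr 'C_G[1]) : simple_obj (mkobj i).
Proof. by rewrite /simple_obj /= group1 class1G repr_set1 eqxx. Qed.

Lemma chargeonE G (X : obj G) : chargeon X -> exists i : Iirr 'C_G[1], X = mkobj i.
Proof. by case: X => [a i] /eqP /= a1; subst a; exists i. Qed.

Lemma fluxionE G (X : obj G) : fluxion X -> X = mkobj (0 : Iirr 'C_G[tag X]).
Proof. by case: X => [a i] /eqP /= i0; subst i. Qed.

Lemma eq_mkobj G a (i j : Iirr 'C_G[a]) : (mkobj i == mkobj j) = (i == j).
Proof. by rewrite eq_Tagged. Qed.

Lemma conj_irr1 G (i : Iirr G) : ('chi_i 1%g)^* = 'chi_i 1%g.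
Proof. by rewrite irr1_degree conjC_nat. Qed.

(** By cardinality the centralizer is exactly the identity together with the class of [a]. It is
    therefore normal, so conjugates of [a] have this same centralizer. *)
Lemma sharp_of_cent G a : a \in G -> a != 1%g ->
  #|'C_G[a]%g| = #|(a ^: G)%g|.+1 -> (a ^: G \subset 'C_G[a])%g ->
  sharp G 'C_G[a].
Proof.
move=> aG a1 cardC subC.
have n1 : 1%g \notin (a ^: G)%g.
  by apply/imsetP=> -[h _ /esym/eqP]; rewrite conjg_eq1 (negPf a1).
have eqK : 'C_G[a]%g = 1%g |: (a ^: G)%g.
  apply/eqP; rewrite eq_sym eqEcard subUset sub1set group1 subC /=.
  by rewrite cardsU1 n1 cardC.
have eqK1 : ('C_G[a]^# = a ^: G)%g by rewrite eqK setU1K.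
have nK : (G \subset 'N('C_G[a]))%g by rewrite eqK normsU ?norms1 ?class_norm.
split=> [||b|b].
- by rewrite /normal subsetIl nK.
- by apply/trivgPn; exists a; rewrite // in_setI aG cent1id.
- rewrite /= eqK1 => /imsetP[h hG ->].
  by rewrite cent1J -{1}(conjGid hG) -conjIg (normsP nK).
by rewrite /= eqK1 => /class_eqP.
Qed.

Lemma modular_sharp G (C F : obj G) :
  simple_obj C -> simple_obj F -> chargeon C -> fluxion F -> C != F ->
  modular_invariant (transp_mx C F) -> exists K : {group gT}, sharp G K.
Proof.
move=> sC sF chC flF CF /(modular_transpP sC sF chC flF)[].
have [i eqC] := chargeonE chC; subst C.
move: (tag F) (fluxionE flF) => a eqF; subst F.
move=> M0 MS; have aG := simple_tag sF; rewrite /= in aG.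
(* The transposition fixes the trivial object, so neither [C] nor [F] can be trivial. *)
have i_n0 : i != 0.
  apply: contraNneq CF => i0; subst i.
  by move: M0; rewrite /transp -[obj0 G]/(mkobj 0) eqxx => /esym/eqP.
have a1 : a != 1%g.
  apply: contraNneq CF => a1; subst a.
  by move: M0; rewrite /transp -[obj0 G]/(mkobj 0) eqxx; case: eqP => [<- //|_ /eqP].
pose z : algC := #|'C_G[a]%g|%:R; pose d := 'chi_i 1%g; pose g : algC := #|G|%:R.
(* Chargeons carry characters of ['C_G[1]], whose index type depends on that group; facts about [G]
   are transported to it one by one. *)
have eqD : 'C_G[1]%g = G by rewrite cent11T setIT.
have cardD : #|'C_G[1]%g| = #|G| by rewrite eqD.
have cardDC x : #|('C_G[1] :&: 'C[x])%g| = #|'C_G[x]%g| by rewrite eqD.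
have inD x : (x \in 'C_G[1]%G) = (x \in G) by rewrite -[LHS]/(x \in 'C_G[1]%g) eqD.
have z0 : z != 0 by apply: neq0CG.
have g0 : g != 0 by apply: neq0CG.
have d0 : d != 0 by apply: irr1_neq0.
(* Comparison of the rows of [C] and [F] at the chargeon with character [j], which the transposition
   fixes. The choice [j = 0] then gives [gE]. *)
have SC j : j != i -> 'chi_j a^-1%g / z = d * 'chi_j 1%g / g.
  move=> ji; have := MS _ _ sC (simple_mkobj1 j).
  rewrite /transp eqxx eq_mkobj (negPf ji).
  have /negPf-> : mkobj j != mkobj (0 : Iirr 'C_G[a]).
    by apply: contraNneq a1 => /(congr1 tag) /= <-.
  rewrite Smx_sym //= !Smx_chargeon // irr0 cfun1E group1 mulr1 => ->.
  by rewrite invg1 /g /d cardD.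
have gE : g = d * z.
  have := SC 0; rewrite eq_sym i_n0 => /(_ isT).
  rewrite irr0 !cfun1E group1 inD groupV aG mulr1 => dz.
  by apply: (mulIf (invr_neq0 z0)); rewrite mulfK // -[RHS](divfK g0) -dz mul1r mulrC.
have Sa j : j != i -> 'chi_j a = 'chi_j 1%g.
  move=> /SC Sj; rewrite -(invgK a) irr_inv.
  have -> : 'chi_j a^-1%g = 'chi_j 1%g.
    rewrite -[LHS](mulfVK z0) Sj gE; field.
    by rewrite z0.
  exact: conj_irr1.
(* By [Sa], the characters other than ['chi_i] contribute the same amount [s] to the column
   orthogonality relations for the pairs (1, a), (a, a) and (1, 1). *)
pose s := \sum_(j | j != i) 'chi_j 1%g * ('chi_j 1%g)^*.
have oD : 1%g \in 'C_G[1]%G by rewrite inD.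
have aD : a \in 'C_G[1]%G by rewrite inD.
have E1 : 'chi_i a * d + s = 0.
  have := second_orthogonality_relation a oD.
  rewrite class1G inE (negPf a1) mulr0n (bigD1 i) //= conj_irr1 => <-.
  by congr (_ + _); apply: eq_bigr => j /Sa ->.
have E2 : 'chi_i a * ('chi_i a)^* + s = z.
  have := second_orthogonality_relation a aD.
  rewrite class_refl mulr1n /= cardDC -/z (bigD1 i) //= => <-.
  by congr (_ + _); apply: eq_bigr => j /Sa ->.
have E3 : d * d + s = g.
  have := second_orthogonality_relation 1%g oD.
  rewrite class_refl mulr1n /= cardDC cardD -/g (bigD1 i) //= conj_irr1 => <-.
  by [].
(* [E3] minus [E1], divided by [d]; [E2] minus [E1] then determines [z]. *)
have pE : 'chi_i a = d - z.
  apply: (mulIf d0); rewrite mulrBl [z * d]mulrC -gE -E3 -[LHS](addrK s) E1.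
  by ring.
have zE : z = d + 1.
  have pc : ('chi_i a)^* = d - z by rewrite pE rmorphB /= conj_irr1 conjC_nat.
  apply: (mulfI z0); move: E1 E2; rewrite pc pE => E1 E2.
  apply/eqP; rewrite -subr_eq0.
  have -> : z * z - z * (d + 1)
            = ((d - z) * (d - z) + s - z) - ((d - z) * d + s) by ring.
  by rewrite E1 E2 subrr subr0.
have cardC : #|'C_G[a]%g| = #|(a ^: G)%g|.+1.
  have : g = #|(a ^: G)%g|%:R * z.
    by rewrite -natrM -index_cent1 mulnC Lagrange ?subsetIl.
  rewrite gE => /(mulIf z0) dE.
  by apply/eqP; rewrite -(eqr_nat algC) -/z zE dE mulrS addrC.
exists 'C_G[a]%G; apply: sharp_of_cent => //.
(* This is S_FF = S_CC. S_FF counts the [h] for which [a ^ h] commutes with [a], and the equality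
   forces that count to be the order of [G]. *)
have := MS _ _ sC sF; rewrite /transp !eqxx eq_sym (negPf CF) Smx_chargeon //.
rewrite Smx_fluxion // (eq_bigr (fun _ => 1)); last first.
  move=> h /andP[_ Ch]; rewrite irr0 cfun1E conjVg groupV.
  by rewrite -[_ \in _]/(_ \in 'C_G[a]%g) Ch.
rewrite sumr_const -/z invg1 -/d /= cardD -/g => SFF.
have {}SFF : #|[pred h in G | (a ^ h)%g \in 'C_G[a]%g]|%:R = g.
  by apply: (mulfI (invr_neq0 (mulf_neq0 z0 z0))); rewrite SFF gE; field; rewrite z0 d0.
have /subset_cardP : #|[pred h in G | (a ^ h)%g \in 'C_G[a]%g]| = #|G|.
  by apply/eqP; rewrite -(eqr_nat algC) SFF.
move/(_ _) => eqG.
apply/subsetP=> _ /imsetP[h hG ->].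
have : h \in [pred h in G | (a ^ h)%g \in 'C_G[a]%g].
  by rewrite eqG //; apply/subsetP=> x /andP[].
by case/andP.
Qed.

End Sharp.

(** * From a sharp normal subgroup to a near-field *)

Section ToNearField.
Variables (gT : finGroupType) (K H : {group gT}) (a : gT).
Hypothesis aK : a \in (K^#)%g.
Hypothesis cKK : abelian K.
Hypothesis nKH : (H \subset 'N(K))%g.
Hypothesis regH : forall x, x \in (K^#)%g ->
  exists2 h, h \in H & (a ^ h^-1 = x)%g.
Hypothesis freeH : {in H &, injective (fun h => (a ^ h^-1)%g)}.

(* The h in H with h a h^-1 = x; recall that x ^ y is y^-1 x y. *)
Definition translator (x : gT) : gT :=
  odflt 1%g [pick h in H | (a ^ h^-1)%g == x].

Lemma translatorP x : x \in (K^#)%g ->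
  translator x \in H /\ (a ^ (translator x)^-1 = x)%g.
Proof.
move=> /regH[h hH hx]; rewrite /translator; case: pickP => [y /andP[yH /eqP] //|].
by move=> /(_ h) /=; rewrite hH hx eqxx.
Qed.

Lemma mem_translator x : x \in (K^#)%g -> translator x \in H.
Proof. by case/translatorP. Qed.

Lemma translatorK x : x \in (K^#)%g -> (a ^ (translator x)^-1)%g = x.
Proof. by case/translatorP. Qed.

Lemma conj_translator h : h \in H -> (a ^ h^-1)%g \in (K^#)%g /\
  translator (a ^ h^-1)%g = h.
Proof.
move=> hH; have ahK : (a ^ h^-1)%g \in (K^#)%g.
  by rewrite memJ_norm // normD1 (subsetP nKH) ?groupV.
by split=> //; apply: freeH; rewrite ?mem_translator ?translatorK.
Qed.

Lemma translator1 : translator a = 1%g.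
Proof. by have [_] := conj_translator (group1 H); rewrite invg1 conjg1. Qed.

Let K1 (x : [subg K]) : x != 1%g -> sgval x \in (K^#)%g.
Proof. by move=> x1; rewrite in_setD1 subgP andbT. Qed.

(** The group identity plays the zero and [a] the one. Left multiplication by a nontrivial [x] is
    conjugation by an element of [H], hence additive; nothing similar holds on the right. *)
Definition tmul (x y : [subg K]) : [subg K] :=
  if x == 1%g then 1%g else subg K (sgval y ^ (translator (sgval x))^-1)%g.

Lemma sgval_tmul x y : x != 1%g ->
  sgval (tmul x y) = (sgval y ^ (translator (sgval x))^-1)%g.
Proof.
move=> x1; rewrite /tmul (negPf x1) subgK // memJ_norm ?subgP // groupV.
by rewrite (subsetP nKH) ?mem_translator ?K1.
Qed.

Definition tone : [subg K] := subg K a.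

Lemma sgval_tone : sgval tone = a.
Proof. by rewrite subgK //; case/setD1P: aK. Qed.

Lemma tone_neq1 : tone != 1%g.
Proof. by rewrite -(inj_eq val_inj) /= sgval_tone; case/setD1P: aK. Qed.

Lemma tmul0l x : tmul 1%g x = 1%g.
Proof. by rewrite /tmul eqxx. Qed.

Lemma tmul0r x : tmul x 1%g = 1%g.
Proof.
have [->|x1] := eqVneq x 1%g; first exact: tmul0l.
by apply: val_inj; rewrite /= sgval_tmul //= conj1g.
Qed.

Lemma tmul_neq1 x y : x != 1%g -> y != 1%g -> tmul x y != 1%g.
Proof.
move=> x1 y1; rewrite -(inj_eq val_inj) /= sgval_tmul // conjg_eq1.
by rewrite -(inj_eq val_inj) in y1.
Qed.

(** The product of the two translators also carries [a] to [tmul x y], and [freeH] leaves only one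
    such element of [H]. Associativity and the morphism property of [of_nf_sdprod] both rest on
    this. *)
Lemma translator_tmul x y : x != 1%g -> y != 1%g ->
  translator (sgval (tmul x y)) =
    (translator (sgval x) * translator (sgval y))%g.
Proof.
move=> x1 y1; have [hx hy] := (mem_translator (K1 x1), mem_translator (K1 y1)).
have [_ <-] := conj_translator (groupM hx hy); rewrite sgval_tmul //.
by rewrite invMg conjgM translatorK ?K1.
Qed.

Lemma tmulA x y z : x != 1%g -> y != 1%g -> z != 1%g ->
  tmul x (tmul y z) = tmul (tmul x y) z.
Proof.
move=> x1 y1 z1; apply: val_inj; rewrite [RHS]sgval_tmul ?tmul_neq1 //.
rewrite /= sgval_tmul // sgval_tmul //.
by rewrite translator_tmul // invMg conjgM.
Qed.

Lemma tmul1l x : x != 1%g -> tmul tone x = x.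
Proof.
move=> _; apply: val_inj; rewrite /= sgval_tmul ?tone_neq1 //.
by rewrite sgval_tone translator1 invg1 conjg1.
Qed.

Lemma tmul1r x : x != 1%g -> tmul x tone = x.
Proof.
move=> x1; apply: val_inj; rewrite /= sgval_tmul //.
by rewrite sgval_tone translatorK ?K1.
Qed.

Lemma tmulV x : x != 1%g -> exists2 y, y != 1%g &
  (tmul y x = tone /\ tmul x y = tone).
Proof.
move=> x1; have hx := mem_translator (K1 x1).
(* The inverse of [x] is the element whose translator is the inverse of that of [x]. *)
have [yK hy] := conj_translator (groupVr hx); rewrite invgK in yK hy.
have [y1 yK'] := setD1P yK.
have y_n1 : subg K (a ^ translator (sgval x))%g != 1%g.
  by rewrite -(inj_eq val_inj) /= subgK.
exists (subg K (a ^ translator (sgval x))%g) => //; split; apply: val_inj => /=.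
  rewrite sgval_tmul // subgK // hy invgK sgval_tone.
  by rewrite -{1}(translatorK (K1 x1)) conjgKV.
by rewrite sgval_tmul // subgK // conjgK sgval_tone.
Qed.

Lemma tmulDr x y z : tmul x (y * z)%g = (tmul x y * tmul x z)%g.
Proof.
have [->|x1] := eqVneq x 1%g; first by rewrite !tmul0l mulg1.
by apply: val_inj; rewrite /= !sgval_tmul //= conjMg.
Qed.

Lemma subg_mulC : commutative (fun x y : [subg K] => x * y)%g.
Proof. by move=> x y; apply: val_inj; rewrite /= (centsP cKK) ?subgP. Qed.

Definition translation_nearField : nearField :=
  @NearField (subg_of K : finType) 1%g (fun x y => x * y)%g (fun x => x^-1)%g tone tmul
    (@mulgA _) subg_mulC (@mul1g _) (@mulVg _) tmul0l tmul0r tone_neq1 tmul_neq1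
    tmulA tmul1l tmul1r tmulV tmulDr.
Local Notation N := translation_nearField.

Definition of_nf_sdprod (p : nf_sdprod N) : gT :=
  (sgval p.1 * translator (sgval (val p.2)))%g.

Lemma of_nf_sdprodM : {in [set: nf_sdprod N] &, {morph of_nf_sdprod : p q / (p * q)%g}}.
Proof.
move=> [x [u u1]] [y [v v1]] _ _; rewrite nf_sdprod_mulE /of_nf_sdprod /=.
rewrite translator_tmul // sgval_tmul // conjgE invgK !mulgA.
by rewrite mulgKV.
Qed.

Lemma nf_sdprod_isog : K :&: H = 1%g -> ([set: nf_sdprod N] \isog (K <*> H))%g.
Proof.
move=> tiKH; apply/isogP; exists (Morphism of_nf_sdprodM).
  apply/subsetP=> -[x [u u1]] /setIP[_]; rewrite !inE /= /of_nf_sdprod /= => /eqP xu1.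
  have hu := mem_translator (K1 u1).
  (* For a kernel element, [sgval x] is the inverse of a translator, so it lies in both [K] and
     [H]. *)
  have x1 : sgval x = 1%g.
    apply/set1gP; rewrite -tiKH inE subgP /=.
    by rewrite (canRL (mulgK _) xu1) mul1g groupV.
  apply/eqP; congr (_, _); apply: val_inj => //=; apply: val_inj => /=.
  rewrite x1 mul1g in xu1; rewrite -(translatorK (K1 u1)) xu1 invg1 conjg1.
  by rewrite sgval_tone.
rewrite /= norm_joinEr // morphimEdom; apply/eqP; rewrite eqEsubset; apply/andP; split.
  apply/subsetP=> _ /imsetP[[x [u u1]] _ ->].
  by rewrite mem_mulg ?subgP //= mem_translator ?K1.
apply/subsetP=> _ /mulsgP[k h kK hH ->].
have [/setD1P[u1 uK] hE] := conj_translator hH.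
have u_n1 : subg K (a ^ h^-1)%g != 1%g by rewrite -(inj_eq val_inj) /= subgK.
apply/imsetP; exists (subg K k, Sub (subg K (a ^ h^-1)%g) u_n1 : nf_units N); first by rewrite inE.
by rewrite /of_nf_sdprod /= !subgK // hE.
Qed.

End ToNearField.

Lemma sharp_nearField (gT : finGroupType) (G K : {group gT}) :
  sharp G K -> exists N : nearField, (G \isog [set: nf_sdprod N])%g.
Proof.
move=> shGK; have [nsKG ntK cK clK] := shGK; have [sKG nKG] := andP nsKG.
have [a aK a1] := trivgPn _ ntK.
have aK1 : a \in (K^#)%g by rewrite in_setD1 a1.
have cKK := sharp_abelian shGK.
(* The index of [K] is the size of the class of [a], which is one less than the order of [K]. *)
have hallK : Hall G K.
  rewrite /Hall sKG -(cK a aK1) index_cent1 clK // cK //= (cardsD1 1%g K) group1.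
  by rewrite coprimeSn.
have /splitsP[H /complP[tiKH defG]] := SchurZassenhaus_split hallK nsKG.
have sHG : H \subset G by rewrite -defG mulG_subr.
have nKH : (H \subset 'N(K))%g := subset_trans sHG nKG.
have defG' : (K <*> H)%g = G by rewrite norm_joinEr.
(* In [g = k * h] the factor [k] centralizes [a], so [h] alone moves [a] to [x]. *)
have reg x : x \in (K^#)%g -> exists2 h, h \in H & (a ^ h^-1 = x)%g.
  rewrite -(clK a) // => /imsetP[g]; rewrite -defG => /mulsgP[k h kK hH ->] ->.
  exists h^-1%g; rewrite ?groupV // invgK conjgM; congr (_ ^ _)%g.
  by apply/esym/conjg_fixP/commgP/(centsP cKK).
(* If [g] and [h] agree on [a], then [h^-1 * g] centralizes [a], so it lies in both [K] and [H]. *)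
have free : {in H &, injective (fun h => (a ^ h^-1)%g)}.
  move=> g h gH hH /= /(canRL (conjgKV _)) e.
  have ghH : (h^-1 * g)%g \in H by rewrite groupM ?groupV.
  apply/eqP; rewrite eq_sym eq_mulVg1; apply/eqP/set1gP; rewrite -tiKH in_setI ghH andbT.
  rewrite -(cK a aK1) in_setI (subsetP sHG) //=.
  by apply/cent1P/commute_sym/commgP/conjg_fixP; rewrite conjgM -e.
exists (translation_nearField aK1 cKK nKH reg free).
rewrite isog_sym -defG'; exact: nf_sdprod_isog.
Qed.

(** * The translations of a near-field *)

Section FromNearField.
Variable N : nearField.
Local Notation G := [set: nf_sdprod N]%G.

Lemma nf_mul1r_all (x : N) : nf_mul x (nf_one N) = x.
Proof. by have [->|x0] := eqVneq x (nf_zero N); [rewrite nf_mul0l | exact: nf_mul1r]. Qed.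

Lemma nf_mulIr (x v w : N) : x != nf_zero N -> nf_mul v x = nf_mul w x -> v = w.
Proof.
move=> /nf_mulV[y _ [_ xy]] /(congr1 (fun z : N => nf_mul z y)) /=.
by rewrite -!nf_mulA_all xy !nf_mul1r_all.
Qed.

Lemma nf_addIr (x v w : N) : nf_add v x = nf_add w x -> v = w.
Proof.
move=> /(congr1 (fun z : N => nf_add z (nf_opp x))) /=; rewrite -!nf_addA.
by rewrite (nf_addC x) nf_addN !(nf_addC _ (nf_zero N)) !nf_add0.
Qed.

Lemma nf_umul1 (u : nf_units N) : nf_umul u (nf_uone N) = u.
Proof. by apply: val_inj; rewrite /= nf_mul1r_all. Qed.

Lemma nf_umul1l (u : nf_units N) : nf_umul (nf_uone N) u = u.
Proof. by apply: val_inj; rewrite /= nf_mul1l_all. Qed.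

Definition nf_trans : {set nf_sdprod N} := [set p : nf_sdprod N | p.2 == nf_uone N].

Lemma nf_trans_group_set : group_set nf_trans.
Proof.
apply/group_setP; split=> [|x y]; first by rewrite inE.
by rewrite !inE nf_sdprod_mulE => /eqP-> /eqP-> /=; rewrite nf_umul1.
Qed.
Canonical nf_trans_group := Group nf_trans_group_set.

Lemma nf_transJ (x y : nf_sdprod N) : x \in nf_trans -> (x ^ y)%g \in nf_trans.
Proof.
rewrite !inE => /eqP x1; rewrite conjgE !nf_sdprod_mulE /= x1 nf_umul1l.
by have /(congr1 snd) /= -> := mulVg y.
Qed.

(** An element with unit part [u] can commute with the translation by [x] only if [u * x = x], which
    forces [u = 1] for nonzero [x]. *)
Lemma nf_sdprod_sharp : sharp G nf_trans_group.
Proof.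
have transE x : x \in (nf_trans^#)%g -> x.2 = nf_uone N /\ x.1 != nf_zero N.
  case: x => x u /=; rewrite !inE /= => /andP[x1 /eqP u1]; split=> //.
  by apply: contraNneq x1 => x0; rewrite x0 u1.
split=> [|||].
- rewrite /normal subsetT; apply/normsP=> y _; apply/setP=> x.
  rewrite mem_conjg; apply/idP/idP=> [/(nf_transJ y)|]; last exact: nf_transJ.
  by rewrite conjgKV.
- apply/trivgPn; exists (nf_one N, nf_uone N); first by rewrite inE.
  by apply/eqP=> -[] /eqP; rewrite (negPf (nf_one_neq0 N)).
- move=> x /transE[u1 x0]; apply/setP=> y; rewrite /= in_setI in_setT [RHS]inE.
  rewrite cent1C cent1E !nf_sdprod_mulE u1 nf_umul1 nf_umul1l.
  apply/eqP/eqP=> [[]|->]; last by rewrite /= !nf_mul1l_all nf_addC.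
  rewrite nf_mul1l_all [RHS]nf_addC => /nf_addIr yx; apply: val_inj.
  by apply: (nf_mulIr x0); rewrite /= nf_mul1l_all.
move=> x xK; have [u1 x0] := transE x xK.
apply/eqP; rewrite eqEsubset; apply/andP; split.
  apply/subsetP=> _ /imsetP[y _ ->]; case/setD1P: xK => x1 xK.
  by rewrite in_setD1 conjg_eq1 x1 nf_transJ.
apply/subsetP=> z /transE[v1 z0]; have [w w0 [wx xw]] := nf_mulV x0.
(* Conjugation by [(0, u)] turns the translation by [x.1] into that by [u * x.1], so [u] is [z.1]
   times the inverse of [x.1]. The witness is [y^-1] because [x ^ y^-1] is [y * x * y^-1]. *)
pose u : nf_units N := Sub (nf_mul z.1 w) (nf_mul_neq0 z0 w0).
pose y : nf_sdprod N := (nf_zero N, u).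
apply/imsetP; exists (y^-1)%g; first by rewrite inE.
rewrite conjgE invgK; apply: (mulIg y); rewrite -mulgA mulgKV.
rewrite !nf_sdprod_mulE u1 v1 nf_umul1 nf_umul1l /= nf_mul0r nf_add0.
by rewrite -nf_mulA_all wx nf_mul1r_all nf_addC nf_add0.
Qed.

End FromNearField.

(** * From a sharp normal subgroup to a modular transposition *)

Section SharpModular.
Variable gT : finGroupType.
Implicit Types G K : {group gT}.

Lemma sharp_card G K : sharp G K -> #|G| = (#|K| * #|K|.-1)%N.
Proof.
case=> _ /trivgPn[a aK a1] cK clK; have aK1 : a \in (K^#)%g by rewrite in_setD1 a1.
rewrite -(Lagrange (subsetIl G 'C[a])) index_cent1 /= cK // clK //.
by rewrite (cardsD1 1%g K) group1.
Qed.

(** The fibres of [y |-> x ^ y] are right cosets of the centralizer of [x]. *)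
Lemma sum_class G x (f : gT -> algC) :
  \sum_(y in G) f (x ^ y)%g = #|'C_G[x]%g|%:R * \sum_(z in (x ^: G)%g) f z.
Proof.
rewrite (partition_big (fun y => (x ^ y)%g) (mem (x ^: G)%g)) /=; last first.
  by move=> y yG; apply: imset_f.
rewrite mulr_sumr; apply: eq_bigr => _ /imsetP[w wG ->].
rewrite (eq_bigr (fun _ => f (x ^ w)%g)) => [|y /andP[_ /eqP->] //].
rewrite sumr_const mulr_natl -(card_rcoset 'C_G[x] w); congr (_ *+ _).
apply: eq_card => y; rewrite mem_rcoset [LHS]inE in_setI groupMr ?groupV //.
have -> : ((y * w^-1)%g \in 'C[x]%g) = ((x ^ (y * w^-1))%g == x).
  by rewrite cent1C; apply/cent1P/eqP=> [/commgP/conjg_fixP|/conjg_fixP/commgP].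
by rewrite conjgM (canF_eq (conjgKV w)).
Qed.

Lemma sum_irr_nontriv G (j : Iirr G) : j != 0 ->
  \sum_(x in (G^#)%g) 'chi_j x = - 'chi_j 1%g.
Proof.
move=> j0; have := cfdot_irr j 0; rewrite (negPf j0) cfdotE => /eqP.
rewrite mulf_eq0 invr_eq0 (negPf (neq0CG G)) /= (big_setD1 1%g) //=.
rewrite irr0 cfun1E group1 conjC1 mulr1 addrC addr_eq0 => /eqP<-.
by apply: eq_bigr => x /setD1P[_ xG]; rewrite cfun1E xG conjC1 mulr1.
Qed.

(* The nontrivial constituent of the doubly transitive action of G on the cosets of a complement of K. *)
Definition sharp_char G K (chi : 'CF(G)) :=
  [/\ chi 1%g = #|K|.-1%:R, {in (K^#)%g, forall x, chi x = -1}
    & forall x, x \notin K -> chi x = 0].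

(** Up to the factor 1/|G| this is an inner product. It yields both the norm of the induced
    character and the consequences of orthogonality to it. *)
Lemma sum_sharp_char G K (chi : 'CF(G)) (f : gT -> algC) (c : algC) :
  sharp G K -> sharp_char K chi -> {in (K^#)%g, forall x, f x = c} ->
  \sum_(x in G) f x * (chi x)^* = #|K|.-1%:R * (f 1%g - c).
Proof.
move=> [nsKG _ _ _] [chi1 chiK chi0] fK.
rewrite (big_setID K) /= (setIidPr (normal_sub nsKG)) [X in _ + X]big1; last first.
  by move=> x /setDP[_ /chi0->]; rewrite conjC0 mulr0.
rewrite (big_setD1 1%g) //= chi1 conjC_nat (eq_bigr (fun _ => - c)); last first.
  by move=> x xK; rewrite fK // chiK // rmorphN1 mulrN1.
rewrite sumr_const (cardsD1 1%g K) group1 -[- c *+ _]mulr_natl /=.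
by ring.
Qed.

Lemma sharp_irr G K : sharp G K -> exists i : Iirr G, sharp_char K 'chi_i.
Proof.
move=> shGK; have [nsKG ntK cK clK] := shGK; have [sKG nKG] := andP nsKG.
have [a aK a1] := trivgPn _ ntK.
have aK1 : a \in (K^#)%g by rewrite in_setD1 a1.
have cKK := sharp_abelian shGK.
have [j j0] : exists j : Iirr K, j != 0.
  apply/existsP; apply: contraR ntK; rewrite negb_exists => /forallP all0.
  rewrite -(card_le1_trivg (G := K)) // -(card_Iirr_abelian cKK).
  by apply/card_le1P=> x _ y; rewrite !inE; move: (all0 x) (all0 y); rewrite !negbK => /eqP-> ->.
have lam1 : 'chi_j 1%g = 1 by apply/lin_char1/char_abelianP.
have shI : sharp_char K ('Ind[G] 'chi_j).
  split=> [|x xK|x xK].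
  - by rewrite cfInd1 // lam1 mulr1 -(cK a aK1) index_cent1 clK // cK // (cardsD1 1%g K) group1.
  (* [sum_class] produces a factor |K| that cancels the normalisation of the induced character,
     leaving the sum of ['chi_j] over [K^#]. *)
  - by rewrite cfIndE // sum_class clK // cK // mulKf ?neq0CG // sum_irr_nontriv // lam1.
  rewrite cfIndE // big1 ?mulr0 // => y yG; rewrite cfun0 //.
  by rewrite memJ_norm // (subsetP nKG).
have : 'Ind[G] 'chi_j \in irr G.
  rewrite irrEchar cfInd_char ?irr_char //=; apply/eqP.
  have [chi1 chiK _] := shI.
  rewrite cfdotE (sum_sharp_char shGK shI chiK) chi1 opprK (sharp_card shGK).
  have n0 : #|K|.-1 != 0%N by rewrite -lt0n -ltnS prednK ?cardG_gt1.
  have kE : #|K|%:R = #|K|.-1%:R + 1 :> algC by rewrite natr1 prednK.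
  rewrite natrM -kE mulrC [_%:R * _]mulrC divff // mulf_neq0 ?neq0CG //.
  by rewrite pnatr_eq0.
by case/irrP=> i eqI; exists i; rewrite -eqI.
Qed.

(** [K^#] is a single class, so ['chi_j] takes one value there; orthogonality to ['chi_i] forces
    that value to be the degree. *)
Lemma sharp_irr_const G K (i j : Iirr G) : sharp G K -> sharp_char K 'chi_i ->
  j != i -> {in (K^#)%g, forall x, 'chi_j x = 'chi_j 1%g}.
Proof.
move=> shGK shi ji x xK; have [_ ntK _ clK] := shGK.
have chijK : {in (K^#)%g, forall y, 'chi_j y = 'chi_j x}.
  by move=> y; rewrite -(clK x) // => /imsetP[g gG ->]; rewrite cfunJ.
have := cfdot_irr j i; rewrite (negPf ji) cfdotE (sum_sharp_char shGK shi chijK).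
move/eqP; rewrite !mulf_eq0 invr_eq0 (negPf (neq0CG G)) pnatr_eq0 /= subr_eq0.
by rewrite -[_ == 0%N]negbK -lt0n -ltnS prednK ?cardG_gt1 // ntK /= => /eqP.
Qed.

End SharpModular.

Section SharpModularInvariant.
Variables (gT : finGroupType) (G K : {group gT}) (a : gT) (i : Iirr 'C_G[1]).
Hypotheses (shGK : sharp G K) (aK1 : a \in (K^#)%g) (shi : sharp_char K 'chi_i).
Hypothesis simple_a : simple_obj (mkobj (0 : Iirr 'C_G[a])).
Local Notation C := (mkobj i : obj G).
Local Notation F := (mkobj (0 : Iirr 'C_G[a]) : obj G).

Lemma group_cent11 : 'C_G[1]%G = G.
Proof. by apply: val_inj; rewrite /= cent11T setIT. Qed.

Lemma card_cent11 : #|'C_G[1]%g| = #|G|.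
Proof. by rewrite cent11T setIT. Qed.

Lemma sharp_pred_neq0 : #|K|.-1%:R != 0 :> algC.
Proof.
have [_ ntK _ _] := shGK.
by rewrite pnatr_eq0 -lt0n -ltnS prednK ?cardG_gt1.
Qed.

Lemma sharp_Smx X : simple_obj X -> X != C -> X != F -> Smx C X = Smx F X.
Proof.
have [nsKG _ cK clK] := shGK; have [sKG nKG] := andP nsKG.
have [a1 aK] := setD1P aK1; have aG := subsetP sKG a aK.
have k0 := neq0CG K; have n0 := sharp_pred_neq0.
case: X => [b j] sX; rewrite -/(mkobj j) => XC XF.
have cardCa : #|'C_G[a]%g| = #|K| by rewrite cK.
have [chi1 chiK chi0] := shi; have bG := simple_tag sX; rewrite /= in bG.
(* For a chargeon [X], both entries equal ['chi_j 1 / |K|]. *)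
have [b1 | b1] := eqVneq b 1%g.
  subst b; rewrite [RHS]Smx_sym // !Smx_chargeon // invg1 chi1 card_cent11 cardCa.
  rewrite irr0 cfun1E group1 mulr1 (sharp_card shGK) natrM.
  have ji : j != i by apply: contraNneq XC => ->.
  have shD : sharp 'C_G[1] K by rewrite group_cent11.
  rewrite (sharp_irr_const shD shi ji (x := a^-1%g)) ?in_setD1 ?eq_invg1 ?a1 ?groupV //.
  by field; rewrite k0 n0.
(* Off [K] both entries vanish: ['chi_i] is zero there, and no conjugate of [a] commutes with
   [b]. *)
have [bK | bK] := boolP (b \in K); last first.
  rewrite Smx_chargeon // chi0 ?groupV // !mul0r Smx_fluxion // big1 ?mulr0 //.
  move=> h /andP[hG /setIP[_ ahb]]; case/negP: bK.
  rewrite -(cK (a ^ h)%g) ?in_setI ?bG 1?cent1C //.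
  by rewrite in_setD1 conjg_eq1 a1 memJ_norm // (subsetP nKG).
(* In [K^#] the only class is that of [a], so [X] differs from [F] in its character alone; both
   entries are then [- 'chi_j 1 / |K|]. *)
have eqba : b = a.
  by apply: (simple_obj_conj sX simple_a); rewrite /= clK // in_setD1 b1.
subst b; have j0 : j != 0 by apply: contraNneq XF => ->.
rewrite Smx_chargeon // Smx_fluxion // chiK ?in_setD1 ?eq_invg1 ?a1 ?groupV //.
rewrite (eq_bigl (fun h => h \in G)) => [|h]; last first.
  case hG: (h \in G) => //=; rewrite -[_ \in _]/(_ \in 'C_G[a]%g) cK //.
  by rewrite memJ_norm // (subsetP nKG).
have aVK : (a^-1)%g \in (K^#)%g by rewrite in_setD1 eq_invg1 a1 groupV.
have -> : \sum_(h in G) 'chi_j (a^-1 ^ h)%g = #|K|%:R * - 'chi_j 1%g.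
  rewrite (sum_class G a^-1%g 'chi_j) clK //; congr (_ * _); first by rewrite cK.
  rewrite -(sum_irr_nontriv j0); apply: eq_bigl => x /=.
  by rewrite -(cK a aK1).
by rewrite !cardCa; field.
Qed.

(** All conjugates of [a] lie in [K], so every [h] counts in S_FF; both entries are (|K| -
    1)/|K|. *)
Lemma sharp_Smx_diag : Smx C C = Smx F F.
Proof.
have [nsKG _ cK clK] := shGK; have [sKG nKG] := andP nsKG.
have [a1 aK] := setD1P aK1; have aG := subsetP sKG a aK.
have k0 := neq0CG K; have n0 := sharp_pred_neq0.
have [chi1 _ _] := shi.
rewrite Smx_chargeon // Smx_fluxion // invg1 chi1 card_cent11.
rewrite (eq_big (fun h => h \in G) (fun _ => 1)) => [|h|h /andP[hG _]]; first 1 last.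
- case hG: (h \in G) => //=; rewrite -[_ \in _]/(_ \in 'C_G[a]%g) cK //.
  by rewrite memJ_norm // (subsetP nKG).
- rewrite irr0 cfun1E conjVg groupV -[_ \in _]/(_ \in 'C_G[a]%g) cK //.
  by rewrite memJ_norm ?aK // (subsetP nKG).
have cardCa : #|'C_G[a]%g| = #|K| by rewrite cK.
rewrite sumr_const (sharp_card shGK) !cardCa natrM.
by field; rewrite k0 n0.
Qed.

Lemma sharp_modular : simple_obj C /\ C != F /\ modular_invariant (transp_mx C F).
Proof.
have [a1 aK] := setD1P aK1; have sC := simple_mkobj1 i.
have [chi1 chiK _] := shi.
have i0 : i != 0.
  apply/eqP=> i0; have := chiK a aK1; rewrite i0 irr0 cfun1E => /esym/eqP.
  by case: (_ \in _); rewrite ?eqNr ?oppr_eq0 oner_eq0.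
have CF : C != F by apply: contraNneq a1 => /(congr1 tag) /= <-.
split=> //; split=> //; apply/modular_transpP=> //; first exact: eqxx.
have [tC tF] := (simple_tag sC, simple_tag simple_a).
have SE X : simple_obj X -> X != C -> X != F -> Smx X C = Smx X F.
  move=> sX XC XF; have tX := simple_tag sX.
  by rewrite Smx_sym // sharp_Smx // Smx_sym.
split.
  rewrite /transp -[obj0 G]/(mkobj 0) eq_mkobj eq_sym (negPf i0).
  by case: eqP => // /(congr1 tag) /= a1'; rewrite a1' eqxx in a1.
move=> X Y sX sY; rewrite /transp.
have [->|XC] := eqVneq X C; have [->|YC] := eqVneq Y C.
- by rewrite Smx_sym.
- by have [->|YF] := eqVneq Y F; rewrite ?sharp_Smx_diag // sharp_Smx.
- have [->|XF] := eqVneq X F; first by rewrite sharp_Smx_diag.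
  exact: SE.
have [->|XF] := eqVneq X F; have [->|YF] := eqVneq Y F => //.
- by rewrite Smx_sym.
- by rewrite sharp_Smx.
by rewrite SE.
Qed.

End SharpModularInvariant.

Lemma sharp_transp (gT : finGroupType) (G K : {group gT}) : sharp G K ->
  exists C F : obj G,
    simple_obj C /\ simple_obj F /\ chargeon C /\ fluxion F /\ C != F /\
    modular_invariant (transp_mx C F).
Proof.
move=> shGK; have [nsKG ntK cK clK] := shGK.
have [a0 a0K a01] := trivgPn _ ntK.
have a0K1 : a0 \in (K^#)%g by rewrite in_setD1 a01.
(* A simple object must use the chosen representative of its class. *)
pose a := repr (a0 ^: G)%g.
have aG : a \in (a0 ^: G)%g by apply: mem_repr (class_refl G a0).
have aK1 : a \in (K^#)%g by rewrite -(clK a0).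
have sF : simple_obj (mkobj (0 : Iirr 'C_G[a])).
  rewrite /simple_obj /= (class_eqP aG) eqxx andbT.
  by case/setD1P: aK1 => _; apply: subsetP (normal_sub nsKG) a.
have shD : sharp 'C_G[1] K.
  by rewrite group_cent11.
have [i shi] := sharp_irr shD.
have [sC [CF modCF]] := sharp_modular shGK aK1 shi sF.
by exists (mkobj i), (mkobj (0 : Iirr 'C_G[a])); split=> //; rewrite /chargeon /fluxion /= !eqxx.
Qed.

Theorem theorem5 :
  (forall (gT : finGroupType) (G : {group gT}) (C F : obj G),
      simple_obj C -> simple_obj F -> chargeon C -> fluxion F -> C != F ->
      modular_invariant (transp_mx C F) ->
      exists N : nearField, (G \isog [set: nf_sdprod N])%g)
  /\
  (forall N : nearField,
      exists C F : obj [set: nf_sdprod N]%G,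
        simple_obj C /\ simple_obj F /\ chargeon C /\ fluxion F /\ C != F /\
        modular_invariant (transp_mx C F)).
Proof.
split=> [gT G C F sC sF chC flF CF modCF|N].
  by have [K /sharp_nearField] := modular_sharp sC sF chC flF CF modCF.
exact: sharp_transp (nf_sdprod_sharp N).
Qed.
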